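(* Let $\Theta=\mathbb{Z}[\mathbb{Z}^2\rtimes\mathbb{Z}]=\mathbb{Z}\langle q_1^{\pm1},q_2^{\pm1},t^{\pm1}\rangle/(q_1q_2=q_2q_1,\ q_1t=tq_2,\ q_2t=tq_1)$. Let $w,x,y,z\in\mathbb{C}$ be such that $\{w,x,yz\}\subset\mathbb{C}$ is an algebraically independent subset (i.e. $w,x,yz$ are algebraically independent over $\mathbb{Q}$). Then the assignments $$q_1\longmapsto\begin{pmatrix} w & 0 \\ 0 & x \end{pmatrix},\qquad q_2\longmapsto\begin{pmatrix} x & 0 \\ 0 & w \end{pmatrix},\qquad t\longmapsto\begin{pmatrix} 0 & y \\ z & 0 \end{pmatrix}$$ define an embedding (injective ring homomorphism) $\Theta\hookrightarrow\mathrm{Mat}_2(\mathbb{C})$.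
   Context: In $\mathbb{Z}^2\rtimes\mathbb{Z}$, the generator $1\in\mathbb{Z}$ acts on $\mathbb{Z}^2$ by swapping the two summands; $q_1,q_2$ generate $\mathbb{Z}^2$ and $t$ generates $\mathbb{Z}$. *)

(* Defs.v *)
From HB Require Import structures.
From mathcomp Require Import all_boot all_order all_algebra.
From mathcomp Require Import zify finmap.
From mathcomp Require Import complex.
From mathcomp Require Import reals.
From mathcomp Require mpoly monalg.

Set Implicit Arguments.
Unset Strict Implicit.
Unset Printing Implicit Defensive.

Import GRing.Theory Num.Theory.

Local Open Scope fset_scope.
Local Open Scope ring_scope.

(* [mpoly] and [monalg] give conflicting meanings to the same notations. *)
Section AlgebraicIndependence.
Import mpoly.

(* The family [a] (not merely its set of values) is algebraically independent
   over Q. *)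
Definition alg_independent (F : numFieldType) (n : nat) (a : n.-tuple F) : Prop :=
  forall p : {mpoly rat[n]},
    (map_mpoly (ratr : rat -> F) p).@[tnth a] = 0 -> p = 0.

End AlgebraicIndependence.

Import monalg.

(* [{malg R[G]}] is the module of finitely supported functions G -> R. The ring
   structure of [monalg] is not available for it when G is a group, because a
   [monomType] has no nontrivial unit; the convolution product is therefore put
   on the copy [groupring R G]. *)
Definition groupring (R : nzRingType) (G : groupType) : Type := {malg R[G]}.

Section GroupRing.
Context (R : nzRingType) (G : groupType).
Implicit Types (g : {malg R[G]}) (k l : G).

HB.instance Definition _ := GRing.Zmodule.on (groupring R G).

Definition gr_of (k : G) : groupring R G := << k >>.

Definition gr_one : {malg R[G]} := << 1%g >>.

Definition gr_mul g1 g2 : {malg R[G]} :=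
  \sum_(k1 <- msupp g1) \sum_(k2 <- msupp g2)
    << g1@_k1 * g2@_k2 *g (k1 * k2)%g >>.

Lemma gr_mulw (d1 d2 : {fset G}) g1 g2 :
  msupp g1 `<=` d1 -> msupp g2 `<=` d2 ->
  gr_mul g1 g2 =
    \sum_(k1 <- d1) \sum_(k2 <- d2) << g1@_k1 * g2@_k2 *g (k1 * k2)%g >>.
Proof.
move=> le_d1 le_d2; rewrite /gr_mul (big_fset_incl _ le_d1) /=.
  apply/eq_bigr=> k1 _; apply/big_fset_incl => // k _ /mcoeff_outdom ->.
  by rewrite mulr0 monalgU0.
move=> k _ /mcoeff_outdom g1k.
by rewrite big1 => // k' _; rewrite g1k mul0r monalgU0.
Qed.

Lemma gr_mul0g : left_zero 0 gr_mul.
Proof. by move=> g; rewrite /gr_mul msupp0 big_seq_fset0. Qed.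

Lemma gr_mulg0 : right_zero 0 gr_mul.
Proof. by move=> g; rewrite /gr_mul big1 // => k _; rewrite msupp0 big_seq_fset0. Qed.

Lemma gr_mulUg c k g :
  gr_mul << c *g k >> g = \sum_(l <- msupp g) << c * g@_l *g (k * l)%g >>.
Proof.
rewrite (gr_mulw msuppU_le (fsubset_refl _)) big_seq_fset1.
by apply/eq_bigr => l _; rewrite mcoeffUU.
Qed.

Lemma gr_mulgU c k g :
  gr_mul g << c *g k >> = \sum_(l <- msupp g) << g@_l * c *g (l * k)%g >>.
Proof.
rewrite (gr_mulw (fsubset_refl _) msuppU_le); apply/eq_bigr=> l _.
by rewrite big_seq_fset1 mcoeffUU.
Qed.

Lemma gr_mulUU c1 c2 k1 k2 :
  gr_mul << c1 *g k1 >> << c2 *g k2 >> = << c1 * c2 *g (k1 * k2)%g >>.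
Proof. by rewrite (gr_mulw msuppU_le msuppU_le) !big_seq_fset1 !mcoeffUU. Qed.

Lemma gr_mulEl g1 g2 :
  gr_mul g1 g2 = \sum_(k1 <- msupp g1) gr_mul << g1@_k1 *g k1 >> g2.
Proof. by apply/eq_bigr=> k _; rewrite gr_mulUg. Qed.

Lemma gr_mulEr g1 g2 :
  gr_mul g1 g2 = \sum_(k2 <- msupp g2) gr_mul g1 << g2@_k2 *g k2 >>.
Proof.
by rewrite [LHS]exchange_big; apply/eq_bigr=> k _; rewrite gr_mulgU.
Qed.

Lemma gr_mul1g : left_id gr_one gr_mul.
Proof.
move=> g; rewrite gr_mulUg [RHS]monalgE.
by apply/eq_bigr=> k _; rewrite mul1r mul1g.
Qed.

Lemma gr_mulg1 : right_id gr_one gr_mul.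
Proof.
move=> g; rewrite gr_mulgU [RHS]monalgE.
by apply/eq_bigr=> k _; rewrite mulr1 mulg1.
Qed.

Lemma gr_mulgDl : left_distributive gr_mul +%R.
Proof.
move=> g1 g2 g.
rewrite [X in _ = X + _](gr_mulw (fsubsetUl _ (msupp g2)) (fsubset_refl _)).
rewrite [X in _ = _ + X](gr_mulw (fsubsetUr (msupp g1) _) (fsubset_refl _)).
rewrite (gr_mulw (msuppD_le _ _) (fsubset_refl _)).
rewrite -big_split /=; apply/eq_bigr=> k1 _.
rewrite -big_split /=; apply/eq_bigr=> k2 _.
by rewrite mcoeffD mulrDl monalgUD.
Qed.

Lemma gr_mulgDr : right_distributive gr_mul +%R.
Proof.
move=> g g1 g2.
rewrite [X in _ = X + _](gr_mulw (fsubset_refl _) (fsubsetUl _ (msupp g2))).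
rewrite [X in _ = _ + X](gr_mulw (fsubset_refl _) (fsubsetUr (msupp g1) _)).
rewrite (gr_mulw (fsubset_refl _) (msuppD_le _ _)).
rewrite -big_split /=; apply/eq_bigr=> k1 _.
rewrite -big_split /=; apply/eq_bigr=> k2 _.
by rewrite mcoeffD mulrDr monalgUD.
Qed.

Lemma gr_mulA : associative gr_mul.
Proof.
move=> g1 g2 g3.
rewrite [RHS](big_morph (gr_mul^~ _) (fun _ _ => gr_mulgDl _ _ _) (gr_mul0g _)).
rewrite gr_mulEl; apply/eq_bigr=> k1 _.
rewrite [LHS](big_morph (gr_mul _) (fun _ _ => gr_mulgDr _ _ _) (gr_mulg0 _)).
rewrite [RHS](big_morph (gr_mul^~ _) (fun _ _ => gr_mulgDl _ _ _) (gr_mul0g _)).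
apply/eq_bigr=> k2 _.
rewrite [LHS](big_morph (gr_mul _) (fun _ _ => gr_mulgDr _ _ _) (gr_mulg0 _)).
by rewrite gr_mulEr; apply/eq_bigr=> k3 _; rewrite !gr_mulUU mulrA mulgA.
Qed.

Lemma gr_one_neq0 : gr_one != 0.
Proof.
by apply/eqP/malgP=> /(_ 1%g) /eqP; rewrite mcoeffUU mcoeff0 oner_eq0.
Qed.

HB.instance Definition _ := GRing.Zmodule_isNzRing.Build (groupring R G)
  gr_mulA gr_mul1g gr_mulg1 gr_mulgDl gr_mulgDr gr_one_neq0.

Lemma gr_ofM k l : gr_of (k * l)%g = gr_of k * gr_of l.
Proof. by rewrite [RHS]gr_mulUU mulr1. Qed.

Lemma gr_of1 : gr_of 1%g = 1.
Proof. by []. Qed.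

End GroupRing.

Arguments gr_of {R G} k.

Definition swap (v : int * int) : int * int := (v.2, v.1).

(* [swap] is its own inverse, so its k-th power is its |k|-th iterate. *)
Definition swap_act (k : int) (v : int * int) : int * int := iter `|k|%N swap v.

(* The semidirect product of Z^2 by Z, with (v, k) standing for v t^k. *)
Definition Z2Z : Type := ((int * int) * int)%type.

HB.instance Definition _ := Choice.on Z2Z.

Definition Z2Z_one : Z2Z := (0, 0).
Definition Z2Z_mul (g h : Z2Z) : Z2Z := (g.1 + swap_act g.2 h.1, g.2 + h.2).
Definition Z2Z_inv (g : Z2Z) : Z2Z := (- swap_act (- g.2) g.1, - g.2).

Lemma swap_actE k v : swap_act k v = if odd `|k|%N then swap v else v.
Proof.
rewrite /swap_act; elim: `|k|%N => //= n ->.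
by case: (odd n) => //=; case: v.
Qed.

Lemma swap_actD k l v : swap_act (k + l) v = swap_act k (swap_act l v).
Proof.
have oddD : odd `|(k + l)%R|%N = odd `|k|%N (+) odd `|l|%N by lia.
rewrite !swap_actE oddD.
by case: (odd `|k|%N); case: (odd `|l|%N) => //=; case: v.
Qed.

Lemma swap_act_additive k u v :
  swap_act k (u + v) = swap_act k u + swap_act k v.
Proof. by rewrite !swap_actE; case: odd. Qed.

Lemma swap_act0 k : swap_act k 0 = 0.
Proof. by rewrite swap_actE; case: odd. Qed.

Lemma swap_actN k v : swap_act k (- v) = - swap_act k v.
Proof. by rewrite !swap_actE; case: odd. Qed.

Lemma Z2Z_mulA : associative Z2Z_mul.
Proof.
move=> [u k] [v l] [w m]; rewrite /Z2Z_mul /= !addrA.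
by rewrite swap_act_additive -swap_actD addrA.
Qed.

Lemma Z2Z_mul1g : left_id Z2Z_one Z2Z_mul.
Proof. by move=> [v k]; rewrite /Z2Z_mul /= !add0r. Qed.

Lemma Z2Z_mulg1 : right_id Z2Z_one Z2Z_mul.
Proof. by move=> [v k]; rewrite /Z2Z_mul /= swap_act0 !addr0. Qed.

Lemma Z2Z_mulVg : left_inverse Z2Z_one Z2Z_inv Z2Z_mul.
Proof. by move=> [v k]; rewrite /Z2Z_mul /= !addNr. Qed.

Lemma Z2Z_mulgV : right_inverse Z2Z_one Z2Z_inv Z2Z_mul.
Proof.
move=> [v k]; rewrite /Z2Z_mul /= swap_actN -swap_actD.
by rewrite !subrr.
Qed.

HB.instance Definition _ := isGroup.Build Z2Z
  Z2Z_mulA Z2Z_mul1g Z2Z_mulg1 Z2Z_mulVg Z2Z_mulgV.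

Definition Theta : nzRingType := groupring int Z2Z.

Definition q1 : Theta := gr_of (((1, 0), 0) : Z2Z).
Definition q2 : Theta := gr_of (((0, 1), 0) : Z2Z).
Definition t : Theta := gr_of (((0, 0), 1) : Z2Z).

Lemma q1q2 : q1 * q2 = q2 * q1.
Proof. by rewrite /q1 /q2 -!gr_ofM. Qed.

Lemma q1t : q1 * t = t * q2.
Proof. by rewrite /q1 /q2 /t -!gr_ofM. Qed.

Lemma q2t : q2 * t = t * q1.
Proof. by rewrite /q1 /q2 /t -!gr_ofM. Qed.

Definition mx2 (F : nzRingType) (a b c d : F) : 'M[F]_2 :=
  \matrix_(i, j) if i == 0 then (if j == 0 then a else b)
                           else (if j == 0 then c else d).

(* Main.v *)
Require Import Defs.
From HB Require Import structures.
From mathcomp Require Import all_boot all_order all_algebra.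
From mathcomp Require Import zify ring finmap.
From mathcomp Require Import complex.
From mathcomp Require Import reals.
From mathcomp Require mpoly monalg.

Set Implicit Arguments.
Unset Strict Implicit.

Import GRing.Theory Num.Theory.
Local Open Scope ring_scope.

(** The representation is made explicit: with u = yz, the square of the image
of t is the scalar u, so with m = floor(k / 2) the group element
q1^a q2^b t^k acts by the diagonal matrix (w^a x^b u^m, x^a w^b u^m), times the
image of t when k is odd.  That this respects the group law is a check by
parities of the exponents of t ([rep_mul]); it extends to the group ring by the
universal property ([groupring_lift]), and the extension is unique because
q1, q2 and t generate the group ([Z2Z_generated]) and the group spans the ring
([groupring_ext]).

For injectivity, the first row of the matrices suffices ([rep_row0]).  The
elements with k even contribute only to its first column, those with k odd only
to its second one, and within one parity class a group element is determined by
the Laurent monomial w^a x^b u^m that it contributes, up to the common factor 1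
or y.  So the kernel is trivial as soon as distinct Laurent monomials in w, x, u
are linearly independent over the integers.  This is what algebraic
independence gives after multiplication by a large power of w x u, which turns
Laurent monomials into ordinary ones ([laurent_monomials_free]). *)

Section LaurentMonomials.
Import mpoly.

Lemma alg_independent_neq0 (F : numFieldType) (n : nat) (a : n.-tuple F) j :
  alg_independent a -> tnth a j != 0.
Proof.
move=> a_indep; apply/eqP => aj0.
have /(a_indep _) X0 : (map_mpoly (ratr : rat -> F) 'X_j).@[tnth a] = 0.
  by rewrite map_mpolyX mevalXU.
have /eqP := mcoeffXU rat j j.
by rewrite X0 mcoeff0 eqxx eq_sym oner_eq0.
Qed.

(** Multiplying the relation by a high power of the product of the [a_j] makes
all exponents nonnegative; the relation then says that a polynomial with
coefficients [c i] on distinct monomials vanishes at [a]. *)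
Lemma laurent_monomials_free (F : numFieldType) (n : nat) (a : n.-tuple F)
    (T : eqType) (s : seq T) (c : T -> int) (e : T -> 'I_n -> int) :
  alg_independent a -> uniq s ->
  {in s &, forall i j, e i =1 e j -> i = j} ->
  \sum_(i <- s) (c i)%:~R * \prod_j tnth a j ^ e i j = 0 ->
  {in s, forall i, c i = 0}.
Proof.
move=> a_indep s_uniq e_inj sum0.
(* Any common bound for all the exponents would do for N. *)
pose N := (\sum_(i <- s) \sum_j `|e i j|)%N.
have leN i j : i \in s -> (`|e i j| <= N)%N.
  move=> si; rewrite /N (big_rem i) //= (bigD1 j) //= -!addnA.
  exact: leq_addr.
pose mon i := [multinom `|(e i j + N%:Z)%R|%N | j < n].
have monE i j : i \in s -> (mon i j)%:Z = e i j + N%:Z.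
  by move=> si; rewrite mnmE; have := leN i j si; lia.
have mon_inj : {in s &, injective mon}.
  move=> i k si sk eq_mon; apply: e_inj => // j.
  by apply: (addIr N%:Z); rewrite -!monE // eq_mon.
have evalX (q : rat) m :
    (map_mpoly (ratr : rat -> F) (q *: 'X_[m])).@[tnth a] =
    ratr q * \prod_j tnth a j ^+ m j.
  by rewrite map_mpolyZ map_mpolyX mevalZ mevalX.
pose p : {mpoly rat[n]} := \sum_(i <- s) (c i)%:~R *: 'X_[mon i].
have p0 : p = 0.
  apply: (a_indep); rewrite -[RHS](mulr0 (\prod_j tnth a j ^+ N)).
  rewrite -[X in _ = _ * X]sum0 mulr_sumr.
  rewrite (raddf_sum (map_mpoly _)) (raddf_sum (meval _)).
  rewrite [LHS]big_seq [RHS]big_seq; apply: eq_bigr => i si.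
  rewrite [LHS]evalX ratr_int mulrCA.
  congr (_ * _); rewrite -big_split /=; apply: eq_bigr => j _.
  rewrite !exprnP monE // addrC -expfzDr //.
  exact: alg_independent_neq0.
move=> i si; apply/eqP; rewrite -(intr_eq0 rat).
have /eqP := congr1 (mcoeff (mon i)) p0.
rewrite mcoeff0 raddf_sum (bigD1_seq i) //= big_seq_cond big1 => [|k].
  by rewrite addr0 mcoeffZ mcoeffX eqxx mulr1.
case/andP=> sk ki; rewrite mcoeffZ mcoeffX.
case: eqP => [/mon_inj eq_ki|_]; last by rewrite mulr0.
by rewrite eq_ki ?eqxx in ki.
Qed.

End LaurentMonomials.

Section IntegralGroupRing.
Import monalg.
Context (G : groupType) (S : nzRingType).

Lemma monalgU_int (c : int) (k : G) :
  << c *g k >> = (gr_of k : groupring int G) *~ c.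
Proof. by rewrite -[c in LHS]intz [LHS](raddfMz (mkmalgU k)). Qed.

Lemma groupring_ext (phi psi : {rmorphism groupring int G -> S}) :
  (forall k, phi (gr_of k) = psi (gr_of k)) -> phi =1 psi.
Proof.
move=> eq_G f; rewrite (monalgE f) !raddf_sum; apply: eq_bigr => k _.
by rewrite monalgU_int !raddfMz; congr (_ *~ _); apply: eq_G.
Qed.

(** The universal property of the integral group ring. The linear
extension of [rho] is multiplicative because integers are central in [S]. *)
Lemma groupring_lift (rho : G -> S) :
  rho 1%g = 1 -> (forall k l, rho (k * l)%g = rho k * rho l) ->
  exists phi : {rmorphism groupring int G -> S},
    (forall k, phi (gr_of k) = rho k) /\
    (forall f, phi f = \sum_(k <- msupp f) (f@_k)%:~R * rho k).
Proof.
move=> rho1 rhoM.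
pose phi : groupring int G -> S := mmap intr rho.
have phiB : zmod_morphism phi by exact: raddfB.
have phiM : monoid_morphism phi.
  split=> [|f g]; first by rewrite /phi mmapU rho1 mulr1.
  rewrite [f * g]/(gr_mul f g) /gr_mul [LHS]raddf_sum mulr_suml.
  apply: eq_bigr => k _; rewrite raddf_sum mulr_sumr; apply: eq_bigr => l _.
  rewrite [LHS]mmapU rhoM /= intrM -!mulrA; congr (_ * _).
  by rewrite !mulrA -(commr_int (rho k)).
pose phiB' := GRing.isZmodMorphism.Build _ _ phi phiB.
pose phiM' := GRing.isMonoidMorphism.Build _ _ phi phiM.
exists (HB.pack_for {rmorphism groupring int G -> S} phi phiB' phiM').
by split=> // k; rewrite [LHS]mmapU mul1r.
Qed.

End IntegralGroupRing.

(** The induction principle saying that q1, q2 and t generate the group; its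
cases for products and inverses are those under which the equality locus of
two homomorphisms is stable. *)
Lemma Z2Z_generated (P : Z2Z -> Prop) :
  P ((1, 0), 0) -> P ((0, 1), 0) -> P ((0, 0), 1) ->
  (forall g h, P g -> P h -> P (g * h)%g) -> (forall g, P g -> P (g^-1)%g) ->
  forall g, P g.
Proof.
move=> P1 P2 Pt PM PV.
have P_one : P 1%g.
  by rewrite -(mulgV (((1, 0), 0) : Z2Z)); apply: (PM) => //; apply: (PV).
have P_exp (e : int -> Z2Z) :
    e 0 = 1%g -> (forall k l, e (k + l) = (e k * e l)%g) -> P (e 1) ->
    forall k, P (e k).
  move=> e0 eD Pe1.
  have Pnat n : P (e n%:Z).
    by elim: n => [|n IHn]; rewrite ?e0 // intS eD; apply: (PM).
  case=> n //; suff -> : e (Negz n) = ((e n.+1%:Z)^-1)%g by apply: (PV).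
  by apply/esym/mulg1_eq; rewrite -eD NegzE subrr.
case=> [[a b] k].
have -> : ((a, b), k) =
    Z2Z_mul (Z2Z_mul ((a, 0), 0) ((0, b), 0)) ((0, 0), k).
  by congr (_, _, _); rewrite /= ?(addr0, add0r).
apply: (PM); first apply: (PM).
- apply: (P_exp (fun a => ((a, 0), 0) : Z2Z)) => //.
- apply: (P_exp (fun b => ((0, b), 0) : Z2Z)) => //.
- apply: (P_exp (fun k => ((0, 0), k) : Z2Z)) => // m n.
  by congr (_, _); rewrite /= swap_act0.
Qed.

Lemma mx2_mul (F : nzRingType) (a b c d a' b' c' d' : F) :
  mx2 a b c d * mx2 a' b' c' d' =
  mx2 (a * a' + b * c') (a * b' + b * d') (c * a' + d * c') (c * b' + d * d').
Proof.
apply/matrixP => i j; rewrite !mxE !big_ord_recl big_ord0 !mxE /= addr0.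
by case: (i == 0); case: (j == 0).
Qed.

Lemma mx2_1 (F : nzRingType) : mx2 (1 : F) 0 0 1 = 1.
Proof.
by apply/matrixP => i j; rewrite !mxE; case: i j => [[|[|i]] ?] [[|[|j]] ?].
Qed.

Section Representation.
Context (F : fieldType) (w x y z : F).
Hypotheses (w_neq0 : w != 0) (x_neq0 : x != 0) (yz_neq0 : y * z != 0).

Definition laurent (v : int * int) (m : int) : F :=
  w ^ v.1 * x ^ v.2 * (y * z) ^ m.

(** [%/] rounds towards minus infinity, so [k] is [2 * m] plus its parity for
negative [k] too. *)
Definition rep (g : Z2Z) : 'M[F]_2 :=
  let m := (g.2 %/ 2)%Z in
  if odd `|g.2|%N
  then mx2 0 (laurent g.1 m * y) (laurent (swap g.1) m * z) 0
  else mx2 (laurent g.1 m) 0 0 (laurent (swap g.1) m).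

Lemma laurentD u v m n : laurent (u + v) (m + n) = laurent u m * laurent v n.
Proof. by rewrite /laurent !expfzDr // !mulrA; ring. Qed.

Lemma rep1 : rep 1%g = 1.
Proof. by rewrite /rep /= /laurent !expr0z !mulr1 mx2_1. Qed.

Lemma swapD u v : swap (u + v) = swap u + swap v.
Proof. by []. Qed.

Lemma swapK : involutive swap.
Proof. by case. Qed.

(** A matrix with zero diagonal exchanges the two diagonal entries of a factor
that it moves past, as t swaps the summands of Z^2; two odd powers of t produce
one more factor yz, which is the carry in the halving of their exponents. *)
Lemma rep_mul g h : rep (g * h)%g = rep g * rep h.
Proof.
case: g h => [u k] [v l].
rewrite -[(_ * _)%g]/(u + swap_act k v, k + l) /rep /= swap_actE swapD.
have -> : odd `|(k + l)%R|%N = odd `|k|%N (+) odd `|l|%N by lia.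
have -> : ((k + l) %/ 2)%Z =
    (k %/ 2)%Z + (l %/ 2)%Z + (odd `|k|%N && odd `|l|%N)%:Z by lia.
have yz v' m : laurent v' (m + 1) = laurent v' m * (y * z).
  rewrite -[v']addr0 laurentD addr0 [laurent 0 1]/laurent.
  by rewrite !expr0z !mul1r expr1z.
case: (odd `|k|%N); case: (odd `|l|%N); rewrite /= ?addr0 ?yz ?swapK;
  rewrite !laurentD mx2_mul !(mul0r, mulr0, addr0, add0r); congr mx2; ring.
Qed.

(** The parity of the exponent of t selects the column, which makes the sum of
the contributions to one entry range over a single parity class. *)
Lemma rep_row0 g (j : 'I_2) :
  rep g ord0 j =
    (odd `|g.2|%N == j :> nat)%:R * (laurent g.1 (g.2 %/ 2)%Z * y ^+ j).
Proof.
rewrite /rep; case: odd; rewrite mxE; case: j => [[|[|j]] ?] //=;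
  by rewrite ?mul0r ?mul1r ?mulr1.
Qed.

End Representation.

Section Injectivity.
Import monalg.

(** The coefficient at [g0] is read off the entry of the first row whose column
is the parity of the exponent of t in [g0]. *)
Lemma rep_free (F : numFieldType) (w x y z : F) (f : {malg int[Z2Z]}) :
  alg_independent [tuple w; x; y * z] ->
  \sum_(g <- msupp f) (f@_g)%:~R * rep w x y z g = 0 -> f = 0.
Proof.
move=> indep f0; apply/malgP => g0; rewrite mcoeff0.
have [g0f|] := boolP (g0 \in msupp f); last by move/mcoeff_outdom.
have yz_neq0 : y * z != 0 :=
  alg_independent_neq0 (Ordinal (isT : 2 < 3)%N) indep.
have y_neq0 : y != 0 by move: yz_neq0; rewrite mulf_eq0 negb_or => /andP[].
pose j : 'I_2 := inord (odd `|g0.2|%N).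
have jE : j = odd `|g0.2|%N :> nat by rewrite inordK //; case: odd.
pose s := [seq g <- msupp f | odd `|g.2|%N == j :> nat].
pose e (g : Z2Z) (i : 'I_3) : int := tnth [tuple g.1.1; g.1.2; (g.2 %/ 2)%Z] i.
have e_inj : {in s &, forall g h, e g =1 e h -> g = h}.
  move=> [[a b] k] [[a' b'] k']; rewrite !mem_filter /=.
  move=> /andP[/eqP kj _] /andP[/eqP k'j _] eq_e.
  have := eq_e ord0; have := eq_e (Ordinal (isT : 1 < 3)%N).
  have := eq_e (Ordinal (isT : 2 < 3)%N).
  rewrite /e !(tnth_nth 0) /= => eq_k -> ->.
  (* The exponents k and k' have equal halves, and the parity j in common. *)
  by have -> : k = k' by lia.
apply: (@laurent_monomials_free _ _ _ _ s (fun g => f@_g) e indep _ e_inj).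
- by rewrite filter_uniq // fset_uniq.
- apply: (mulIf (expf_neq0 j y_neq0)); rewrite mul0r.
  have := congr1 (fun A : 'M[F]_2 => A ord0 j) f0.
  rewrite /= summxE mxE => entry0.
  rewrite -[RHS]entry0 mulr_suml /s big_filter big_mkcond /=.
  apply: eq_bigr => g _.
  rewrite [in RHS]mulrzl -scaler_int mxE rep_row0.
  case: eqP => _; last by rewrite mul0r mulr0.
  rewrite !big_ord_recl big_ord0 /e !(tnth_nth 0) /=.
  by rewrite mulr1 mul1r /laurent !mulrA.
by rewrite mem_filter g0f jE eqxx.
Qed.

End Injectivity.

Theorem proposition0p4 (R : realType) (w x y z : R[i]) :
  alg_independent [tuple w; x; y * z] ->
  exists phi : {rmorphism Theta -> 'M[R[i]]_2},
    [/\ [/\ phi q1 = mx2 w 0 0 x, phi q2 = mx2 x 0 0 w & phi t = mx2 0 y z 0],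
        forall psi : {rmorphism Theta -> 'M[R[i]]_2},
          [/\ psi q1 = mx2 w 0 0 x, psi q2 = mx2 x 0 0 w & psi t = mx2 0 y z 0] ->
          psi =1 phi
      & injective phi].
Proof.
move=> indep.
have w_neq0 : w != 0 := alg_independent_neq0 ord0 indep.
have x_neq0 : x != 0 := alg_independent_neq0 (Ordinal (isT : 1 < 3)%N) indep.
have yz_neq0 : y * z != 0 :=
  alg_independent_neq0 (Ordinal (isT : 2 < 3)%N) indep.
have [phi [phi_of phiE]] := groupring_lift (rep1 w x y z)
  (rep_mul w_neq0 x_neq0 yz_neq0).
have phi_gens :
    [/\ phi q1 = mx2 w 0 0 x, phi q2 = mx2 x 0 0 w & phi t = mx2 0 y z 0].
  by split; rewrite phi_of /rep /laurent /= ?expr0z ?expr1z ?mulr1 ?mul1r.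
case: (phi_gens) => phi1 phi2 phit.
exists phi; split.
- exact: phi_gens.
- move=> psi [psi1 psi2 psit]; apply: groupring_ext.
  apply: Z2Z_generated.
  + by rewrite [LHS]psi1 -phi1.
  + by rewrite [LHS]psi2 -phi2.
  + by rewrite [LHS]psit -phit.
  + by move=> g h psig psih; rewrite gr_ofM !rmorphM psig psih.
  + move=> g psig.
    (* Left and right inverses of the common value agree. *)
    have phiV : phi (gr_of g) * phi (gr_of g^-1%g) = 1.
      by rewrite -rmorphM -gr_ofM mulgV gr_of1 rmorph1.
    have psiV : psi (gr_of g^-1%g) * psi (gr_of g) = 1.
      by rewrite -rmorphM -gr_ofM mulVg gr_of1 rmorph1.
    by rewrite -[LHS]mulr1 -phiV mulrA -psig psiV mul1r.
- apply: raddf_inj => f phif0.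
  by apply: (rep_free indep); rewrite -phiE.
Qed.
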